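(* Let $\mathbb{X}$ be a Cartesian tangent category with a curve object $(C,c_1,c_0)$, and let $\sigma: C\times C\to C$ be the (unique) solution of the system $(C,c_1,1_C)$. Then $(C,\sigma,c_0)$ is a commutative monoid in $\mathbb{X}$ (with multiplication $\sigma$ and unit $c_0:1\to C$).
   Context: Composition is written in diagrammatic order: $fg$ means first $f$, then $g$. A tangent category is a category $\mathbb{X}$ with a functor $T:\mathbb{X}\to\mathbb{X}$ and natural transformations $p:T\to 1$, $0:1\to T$, $+:T_2\to T$, $\ell:T\to T^2$, $c:T^2\to T^2$ such that: (1) for all $M,n$ the fibre power $T_nM$ of $n$ copies of $p_M:TM\to M$ exists and is preserved by every $T^k$; (2) $(p_M,+_M,0_M)$ is an additive bundle, i.e. a commutative monoid in $\mathbb{X}/M$; (3) $(\ell_M,0_M)$ is an additive bundle morphism (commuting square preserving addition and zero) from $(p_M,+_M,0_M)$ to $(T(p_M),T(+_M),T(0_M))$, and $(c_M,1_{TM})$ is one from $(T(p_M),T(+_M),T(0_M))$ to $(p_{TM},+_{TM},0_{TM})$; (4) $cc=1$, $\ell c=\ell$, $\ell T(\ell)=\ell\ell_T$, $T(c)c_TT(c)=c_TT(c)c_T$, $\ell_TT(c)c_T=cT(\ell)$; (5) with $v:=\langle\pi_0\ell,\pi_10_{TM}\rangle T(+):T_2M\to T^2M$, the square $vT(p)=\pi_0p0$ exhibits $T_2M$ as the pullback of $T(p_M)$ along $0_M$, and this pullback is preserved by every $T^k$. It is Cartesian if it has finite products (terminal object $1$, unique maps to it written $!$) and $T$ preserves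 them; $T(A\times B)$ is identified with $TA\times TB$. Object subscripts are often omitted. A vector field on $M$ is a map $V:M\to TM$ with $Vp=1_M$. A dynamical system $(M,V,g)$ is a vector field $V$ on $M$ with a map $g:1\to M$. Given a fixed dynamical system $(C,c_1,c_0)$: a parameterized dynamical system (or system) $(M,V,g)$ is a vector field $V:M\to TM$ with a map $g:X\to M$; a solution of it is a map $\gamma:C\times X\to M$ with $\langle !c_0,1\rangle\gamma=g$ and $(c_1\times 0)T(\gamma)=\gamma V$. A curve object is a dynamical system $(C,c_1,c_0)$ such that: (Preinitial) every parameterized dynamical system has at most one solution; (Commutativity of $c_1$) $c_1T(c_1)c=c_1T(c_1)$; (Completeness of $c_1$) the system $(C,c_1,1_C)$ has a solution. *)

(* Defs.v *)
From mathcomp Require Import all_boot.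

Set Implicit Arguments.
Unset Strict Implicit.
Unset Printing Implicit Defensive.

(** Categories.  Morphisms are compared with Leibniz equality, and composition
    is written in diagrammatic order: [f \; g] is "first f, then g". *)

Declare Scope cat_scope.
Delimit Scope cat_scope with cat.
Local Open Scope cat_scope.

Reserved Notation "A ~> B" (at level 99, B at level 200).

Record category := Category {
  ob :> Type;
  hom : ob -> ob -> Type;
  idm : forall A, hom A A;
  mcomp : forall A B C, hom A B -> hom B C -> hom A C;
  comp1m : forall A B (f : hom A B), mcomp (idm A) f = f;
  compm1 : forall A B (f : hom A B), mcomp f (idm B) = f;
  compA : forall A B C D (f : hom A B) (g : hom B C) (h : hom C D),
    mcomp f (mcomp g h) = mcomp (mcomp f g) h
}.

Notation "A ~> B" := (hom A B) : cat_scope.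
Notation "f \; g" := (mcomp f g) : cat_scope.
Arguments idm {_} A.

Record functor (X Y : category) := Functor {
  fob :> X -> Y;
  fmap : forall A B, (A ~> B) -> (fob A ~> fob B);
  fmap1 : forall A, fmap (idm A) = idm (fob A);
  fmapM : forall A B C (f : A ~> B) (g : B ~> C),
    fmap (f \; g) = fmap f \; fmap g
}.
Arguments fmap {X Y} F {A B} f : rename.

Definition idF (X : category) : functor X X :=
  @Functor X X (fun A => A) (fun _ _ f => f) (fun _ => erefl)
    (fun _ _ _ _ _ => erefl).

Lemma compF_id (X Y Z : category) (F : functor X Y) (G : functor Y Z) A :
  fmap G (fmap F (idm A)) = idm (G (F A)).
Proof. by rewrite !fmap1. Qed.

Lemma compF_comp (X Y Z : category) (F : functor X Y) (G : functor Y Z)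
    A B C (f : A ~> B) (g : B ~> C) :
  fmap G (fmap F (f \; g)) = fmap G (fmap F f) \; fmap G (fmap F g).
Proof. by rewrite !fmapM. Qed.

Definition compF (X Y Z : category) (F : functor X Y) (G : functor Y Z) :
    functor X Z :=
  @Functor X Z (fun A => G (F A)) (fun _ _ f => fmap G (fmap F f))
    (compF_id F G) (@compF_comp _ _ _ F G).

Fixpoint iterF (X : category) (k : nat) (T : functor X X) : functor X X :=
  if k is k'.+1 then compF (iterF k' T) T else idF X.

Record nat_trans (X Y : category) (F G : functor X Y) := NatTrans {
  ntc :> forall A, F A ~> G A;
  ntP : forall A B (f : A ~> B), fmap F f \; ntc B = ntc A \; fmap G f
}.

Section Limits.
Variable X : category.

Record is_terminal (U : X) := IsTerminal {
  bang : forall A, A ~> U;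
  bang_uniq : forall A (f : A ~> U), f = bang A
}.

(* Universal properties are recorded together with the mediating maps, so
   that pairings can occur in formulas; these maps are uniquely determined. *)
Record is_product (A B P : X) (p0 : P ~> A) (p1 : P ~> B) := IsProduct {
  pairing : forall Z, (Z ~> A) -> (Z ~> B) -> (Z ~> P);
  pairing0 : forall Z (f : Z ~> A) (g : Z ~> B), pairing f g \; p0 = f;
  pairing1 : forall Z (f : Z ~> A) (g : Z ~> B), pairing f g \; p1 = g;
  pairing_ext : forall Z (h k : Z ~> P),
    h \; p0 = k \; p0 -> h \; p1 = k \; p1 -> h = k
}.

Definition is_pullback (A B D P : X) (f : A ~> D) (g : B ~> D)
    (u : P ~> A) (w : P ~> B) : Prop :=
  u \; f = w \; g /\
  forall Z (a : Z ~> A) (b : Z ~> B), a \; f = b \; g ->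
    exists! h : Z ~> P, h \; u = a /\ h \; w = b.

(* The n-fold fibre power of q : E -> B, i.e. the n-fold power of q in the
   slice over B.  The leg to B is explicit so that the case n = 0 (where the
   fibre power is B itself) is covered. *)
Record is_fibre_power n (E B : X) (q : E ~> B) (P : X) (b : P ~> B)
    (pi : 'I_n -> P ~> E) := IsFibrePower {
  fp_comm : forall i, pi i \; q = b;
  fp_tuple : forall Z (a : Z ~> B) (f : 'I_n -> Z ~> E),
    (forall i, f i \; q = a) -> (Z ~> P);
  fp_tuple_base : forall Z (a : Z ~> B) (f : 'I_n -> Z ~> E)
    (e : forall i, f i \; q = a), fp_tuple e \; b = a;
  fp_tuple_proj : forall Z (a : Z ~> B) (f : 'I_n -> Z ~> E)
    (e : forall i, f i \; q = a) i, fp_tuple e \; pi i = f i;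
  fp_ext : forall Z (h k : Z ~> P),
    h \; b = k \; b -> (forall i, h \; pi i = k \; pi i) -> h = k
}.

Record fibre_power n (E B : X) (q : E ~> B) := FibrePower {
  fp_ob :> X;
  fp_base : fp_ob ~> B;
  fp_proj : 'I_n -> fp_ob ~> E;
  fp_univ : is_fibre_power q fp_base fp_proj
}.

Lemma fp_projE n (E B : X) (q : E ~> B) (P : fibre_power n q) i :
  fp_proj P i \; q = fp_base P.
Proof. exact: (fp_comm (fp_univ P)). Qed.

Lemma fp_projEE n (E B : X) (q : E ~> B) (P : fibre_power n q) i j :
  fp_proj P i \; q = fp_proj P j \; q.
Proof. by rewrite !fp_projE. Qed.

Definition two_fun (Z E : X) (f g : Z ~> E) : 'I_2 -> Z ~> E :=
  fun i => if i == ord0 then f else g.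

Lemma two_funP (Z E B : X) (q : E ~> B) (f g : Z ~> E) :
  f \; q = g \; q -> forall i, two_fun f g i \; q = f \; q.
Proof. by move=> e i; rewrite /two_fun; case: ifP. Qed.

Definition fp_pair (E B : X) (q : E ~> B) (P : fibre_power 2 q)
    Z (f g : Z ~> E) (e : f \; q = g \; q) : Z ~> P :=
  fp_tuple (fp_univ P) (two_funP e).

Definition fp_pi0 (E B : X) (q : E ~> B) (P : fibre_power 2 q) : P ~> E :=
  fp_proj P ord0.
Definition fp_pi1 (E B : X) (q : E ~> B) (P : fibre_power 2 q) : P ~> E :=
  fp_proj P ord_max.

Section Pair.
Variables (E B : X) (q : E ~> B) (P : fibre_power 2 q).

Lemma fp_piE : fp_pi0 P \; q = fp_pi1 P \; q.
Proof. exact: fp_projEE. Qed.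

Lemma fp_pair0 Z (f g : Z ~> E) (e : f \; q = g \; q) :
  fp_pair P e \; fp_pi0 P = f.
Proof. by rewrite /fp_pair /fp_pi0 fp_tuple_proj. Qed.

Lemma fp_pair1 Z (f g : Z ~> E) (e : f \; q = g \; q) :
  fp_pair P e \; fp_pi1 P = g.
Proof. by rewrite /fp_pair /fp_pi1 fp_tuple_proj. Qed.

Lemma fp_pair_base Z (f g : Z ~> E) (e : f \; q = g \; q) :
  fp_pair P e \; fp_base P = f \; q.
Proof. by rewrite /fp_pair fp_tuple_base. Qed.

Lemma fp_pair_ext Z (h k : Z ~> P) :
  h \; fp_pi0 P = k \; fp_pi0 P -> h \; fp_pi1 P = k \; fp_pi1 P -> h = k.
Proof.
move=> e0 e1; apply: (fp_ext (fp_univ P)).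
  by rewrite -(fp_projE P ord0) !compA; congr (_ \; _).
move=> [[|[|m]] Hi] //.
  by have -> : Ordinal Hi = ord0 by exact: val_inj.
by have -> : Ordinal Hi = ord_max by exact: val_inj.
Qed.

End Pair.
End Limits.

Arguments fp_pair {X E B q} P {Z f g} e.
Arguments bang {X U} _ A : rename.
Arguments pairing {X A B P p0 p1} _ {Z} f g : rename.

Section Bundles.
Variable X : category.

(* The data (q, +, 0) of an additive bundle q : E -> B, with chosen fibre
   powers E_n; the axioms are in [additive_bundle]. *)
Record bundle := Bundle {
  btot : X;
  bbase : X;
  bproj : btot ~> bbase;
  bpow : forall n, fibre_power n bproj;
  badd : bpow 2 ~> btot;
  bzero : bbase ~> btot
}.

Section Additive.
Variable b : bundle.
Let E := btot b.
Let q := bproj b.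
Let E3 := bpow b 3.
Let x0 : E3 ~> E := fp_proj E3 ord0.
Let x1 : E3 ~> E := fp_proj E3 (Ordinal (isT : 1 < 3)).
Let x2 : E3 ~> E := fp_proj E3 ord_max.

Definition add_over : Prop := badd b \; q = fp_base (bpow b 2).
Definition zero_over : Prop := bzero b \; q = idm (bbase b).

Lemma pair_add_over (H : add_over) Z (f g : Z ~> E) (e : f \; q = g \; q) :
  (fp_pair (bpow b 2) e \; badd b) \; q = f \; q.
Proof. by rewrite -compA H fp_pair_base. Qed.

Lemma assoc_left_over (H : add_over) (e : x0 \; q = x1 \; q) :
  (fp_pair (bpow b 2) e \; badd b) \; q = x2 \; q.
Proof. by rewrite pair_add_over //; exact: fp_projEE. Qed.

Lemma assoc_right_over (H : add_over) (e : x1 \; q = x2 \; q) :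
  x0 \; q = (fp_pair (bpow b 2) e \; badd b) \; q.
Proof. by rewrite pair_add_over //; exact: fp_projEE. Qed.

Lemma zero_left_over (H : zero_over) : (q \; bzero b) \; q = idm E \; q.
Proof. by rewrite -compA H compm1 comp1m. Qed.

(* (q, +, 0) is a commutative monoid in the slice over the base.  The maps
   being paired are carried by the compatibility proof passed to [fp_pair]:
   the last four equations are
     <<x0, x1> +, x2> + = <x0, <x1, x2> +> +   on E_3,
     <q 0, 1> + = 1,   <1, q 0> + = 1,   <pi_1, pi_0> + = +. *)
Record additive_bundle : Prop := AdditiveBundle {
  ab_add_over : add_over;
  ab_zero_over : zero_over;
  ab_assoc :
    fp_pair (bpow b 2)
      (assoc_left_over ab_add_over (fp_projEE E3 _ _)) \; badd b
    = fp_pair (bpow b 2)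
      (assoc_right_over ab_add_over (fp_projEE E3 _ _)) \; badd b;
  ab_add0b : fp_pair (bpow b 2) (zero_left_over ab_zero_over) \; badd b = idm E;
  ab_addb0 :
    fp_pair (bpow b 2) (esym (zero_left_over ab_zero_over)) \; badd b = idm E;
  ab_comm : fp_pair (bpow b 2) (esym (fp_piE (bpow b 2))) \; badd b = badd b
}.
End Additive.

Lemma square_pair (b b' : bundle) (f : btot b ~> btot b')
    (g : bbase b ~> bbase b') (H : f \; bproj b' = bproj b \; g) :
  (fp_pi0 (bpow b 2) \; f) \; bproj b' = (fp_pi1 (bpow b 2) \; f) \; bproj b'.
Proof. by rewrite -!compA H !compA fp_piE. Qed.

Record bundle_morphism (b b' : bundle) (f : btot b ~> btot b')
    (g : bbase b ~> bbase b') : Prop := BundleMorphism {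
  bm_square : f \; bproj b' = bproj b \; g;
  bm_add : badd b \; f
    = fp_pair (bpow b' 2) (square_pair bm_square) \; badd b';
  bm_zero : bzero b \; f = g \; bzero b'
}.
End Bundles.

(* The functor T, the projection p : T -> 1, and the fibre powers T_n M of
   p_M, which are preserved by every T^k. *)
Record pre_tangent (X : category) := PreTangent {
  tfun :> functor X X;
  tp : nat_trans tfun (idF X);
  tpow : forall n M, fibre_power n (tp M);
  tpow_preserved : forall k n M,
    is_fibre_power (fmap (iterF k tfun) (tp M))
      (fmap (iterF k tfun) (fp_base (tpow n M)))
      (fun i => fmap (iterF k tfun) (fp_proj (tpow n M) i))
}.

Section T2.
Variables (X : category) (T : pre_tangent X).
Local Notation p := (tp T).

Lemma T2_map_over A B (f : A ~> B) :
  (fp_pi0 (tpow T 2 A) \; fmap T f) \; p B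
  = (fp_pi1 (tpow T 2 A) \; fmap T f) \; p B.
Proof. by rewrite -!compA !ntP !compA fp_piE. Qed.

Definition T2_map A B (f : A ~> B) : tpow T 2 A ~> tpow T 2 B :=
  fp_pair (tpow T 2 B) (T2_map_over f).

Lemma T2_map1 A : T2_map (idm A) = idm (fp_ob (tpow T 2 A)).
Proof.
by apply: fp_pair_ext; rewrite /T2_map ?fp_pair0 ?fp_pair1 fmap1 compm1 comp1m.
Qed.

Lemma T2_mapM A B C (f : A ~> B) (g : B ~> C) :
  T2_map (f \; g) = T2_map f \; T2_map g.
Proof.
apply: fp_pair_ext; rewrite -compA /T2_map.
  by rewrite !fp_pair0 !compA fp_pair0 fmapM compA.
by rewrite !fp_pair1 !compA fp_pair1 fmapM compA.
Qed.

Definition T2F : functor X X :=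
  @Functor X X (fun M => tpow T 2 M) T2_map T2_map1 T2_mapM.

(* T(T_n M) as the n-fold fibre power of T(p_M) *)
Definition Tpow n M : fibre_power n (fmap T (p M)) :=
  FibrePower (tpow_preserved T 1 n M).
End T2.

Record tangent_data (X : category) := TangentData {
  td_pre :> pre_tangent X;
  tzero : nat_trans (idF X) td_pre;
  tplus : nat_trans (T2F td_pre) td_pre;
  tlift : nat_trans td_pre (compF td_pre td_pre);
  tflip : nat_trans (compF td_pre td_pre) (compF td_pre td_pre)
}.

Section TangentAxioms.
Variables (X : category) (T : tangent_data X).
Local Notation p := (tp T).
Local Notation z := (tzero T).
Local Notation add := (tplus T).
Local Notation l := (tlift T).
Local Notation c := (tflip T).

(* (p_M, +_M, 0_M) *)
Definition tbundle (M : X) : bundle X :=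
  @Bundle X (T M) M (p M) (fun n => tpow T n M) (add M) (z M).

(* (T(p_M), T(+_M), T(0_M)) *)
Definition Tbundle (M : X) : bundle X :=
  @Bundle X (T (T M)) (T M) (fmap T (p M)) (fun n => Tpow T n M)
    (fmap T (add M)) (fmap T (z M)).

Lemma v_over (M : X) (H : l M \; fmap T (p M) = p M \; z M)
    (H0 : z M \; p M = idm M) :
  (fp_pi0 (tpow T 2 M) \; l M) \; fmap T (p M)
  = (fp_pi1 (tpow T 2 M) \; z (T M)) \; fmap T (p M).
Proof.
rewrite -!compA H.
have -> : z (T M) \; fmap T (p M) = p M \; z M by rewrite -(ntP z).
by rewrite !compA fp_piE.
Qed.

(* v = <pi_0 l, pi_1 0> T(+) : T_2 M -> T^2 M; the hypotheses make the pairing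
   into T(T_2 M) well defined and are instances of the axioms. *)
Definition tv (M : X) (H : l M \; fmap T (p M) = p M \; z M)
    (H0 : z M \; p M = idm M) : tpow T 2 M ~> T (T M) :=
  fp_pair (Tpow T 2 M) (v_over H H0) \; fmap T (add M).

Record tangent_axioms : Prop := TangentAxioms {
  ta_additive : forall M, additive_bundle (tbundle M);
  ta_lift : forall M,
    @bundle_morphism X (tbundle M) (Tbundle M) (l M) (z M);
  ta_flip : forall M,
    @bundle_morphism X (Tbundle M) (tbundle (T M)) (c M) (idm (T M));
  ta_flip_flip : forall M, c M \; c M = idm (T (T M));
  ta_lift_flip : forall M, l M \; c M = l M;
  ta_lift_lift : forall M, l M \; fmap T (l M) = l M \; l (T M);
  ta_flip3 : forall M,
    fmap T (c M) \; (c (T M) \; fmap T (c M))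
    = c (T M) \; (fmap T (c M) \; c (T M));
  ta_lift_flip2 : forall M,
    l (T M) \; (fmap T (c M) \; c (T M)) = c M \; fmap T (l M);
  ta_universal : forall k M,
    is_pullback
      (fmap (iterF k T) (fmap T (p M)))
      (fmap (iterF k T) (z M))
      (fmap (iterF k T)
        (tv (bm_square (ta_lift M)) (ab_zero_over (ta_additive M))))
      (fmap (iterF k T) (fp_pi0 (tpow T 2 M) \; p M))
}.
End TangentAxioms.

Record tangent_structure (X : category) := TangentStructure {
  ts_data :> tangent_data X;
  ts_axioms : tangent_axioms ts_data
}.

Record finite_products (X : category) := FiniteProducts {
  fpr_one : X;
  fpr_one_terminal : is_terminal fpr_one;
  fpr_prod : X -> X -> X;
  fpr_fst : forall A B, fpr_prod A B ~> A;
  fpr_snd : forall A B, fpr_prod A B ~> B;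
  fpr_prod_univ : forall A B, is_product (fpr_fst A B) (fpr_snd A B)
}.

Record preserves_products (X : category) (P : finite_products X)
    (T : functor X X) := PreservesProducts {
  pp_one : is_terminal (T (fpr_one P));
  pp_prod : forall A B,
    is_product (fmap T (fpr_fst P A B)) (fmap T (fpr_snd P A B))
}.

Record cartesian_tangent_category := CartesianTangentCategory {
  ctc_cat :> category;
  ctc_tan : tangent_structure ctc_cat;
  ctc_prod : finite_products ctc_cat;
  ctc_preserves : preserves_products ctc_prod ctc_tan
}.

Section CartesianTangent.
Variable X : cartesian_tangent_category.
Local Notation T := (ctc_tan X).
Local Notation p := (tp T).
Local Notation z := (tzero T).
Local Notation c := (tflip T).
Local Notation fst := (fpr_fst (ctc_prod X) _ _).
Local Notation snd := (fpr_snd (ctc_prod X) _ _).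

Definition oneo : X := fpr_one (ctc_prod X).
Definition to_one (A : X) : A ~> oneo := bang (fpr_one_terminal (ctc_prod X)) A.
Definition prodo (A B : X) : X := fpr_prod (ctc_prod X) A B.
Local Notation "A ** B" := (prodo A B) (at level 40, left associativity) : cat_scope.

Definition pairm (Z A B : X) (f : Z ~> A) (g : Z ~> B) : Z ~> A ** B :=
  pairing (fpr_prod_univ (ctc_prod X) A B) f g.

Definition crossm (A A' B B' : X) (f : A ~> A') (g : B ~> B') :
    A ** B ~> A' ** B' :=
  pairm (fst \; f) (snd \; g).

(* f x g : A x B -> TA' x TB' = T(A' x B'), where the identification is
   made by pairing into the product cone (T(fst), T(snd)). *)
Definition Tcross (A A' B B' : X) (f : A ~> T A') (g : B ~> T B') :
    A ** B ~> T (A' ** B') :=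
  pairing (pp_prod (ctc_preserves X) A' B') (fst \; f) (snd \; g).

Record comm_monoid (M : X) (m : M ** M ~> M) (e : oneo ~> M) : Prop :=
  CommMonoid {
    cm_assoc :
      crossm m (idm M) \; m
      = pairm (fst \; fst) (pairm (fst \; snd) snd) \; (crossm (idm M) m \; m);
    cm_unitl : pairm (to_one M \; e) (idm M) \; m = idm M;
    cm_unitr : pairm (idm M) (to_one M \; e) \; m = idm M;
    cm_comm : pairm snd fst \; m = m
  }.

Definition vector_field (M : X) (V : M ~> T M) : Prop := V \; p M = idm M.

Section Solutions.
Variables (C : X) (c1 : C ~> T C) (c0 : oneo ~> C).

(* gamma solves the system (M, V, g) with parameter object Z *)
Definition is_solution (M Z : X) (V : M ~> T M) (g : Z ~> M)
    (gamma : C ** Z ~> M) : Prop :=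
  pairm (to_one Z \; c0) (idm Z) \; gamma = g /\
  Tcross c1 (z Z) \; fmap T gamma = gamma \; V.

Record curve_object : Prop := CurveObject {
  co_vector_field : vector_field c1;
  co_preinitial : forall (M Z : X) (V : M ~> T M) (g : Z ~> M),
    vector_field V -> forall gamma gamma' : C ** Z ~> M,
    is_solution V g gamma -> is_solution V g gamma' -> gamma = gamma';
  co_commutative : c1 \; (fmap T c1 \; c C) = c1 \; fmap T c1;
  co_complete : exists sigma : C ** C ~> C, is_solution c1 (idm C) sigma
}.
End Solutions.
End CartesianTangent.

(* Main.v *)
From mathcomp Require Import all_boot.
Require Import Defs.

(** A solution [gamma] of a parameterized system is pinned down by its value at
    [c0] and its derivative in the first variable, by preinitiality, so each
    monoid law is obtained by checking that its two sides solve the same system.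
    Write [sigma (x, y)] with [x] the time variable.

    - The left unit law is the initial condition of [sigma].
    - Right unit: [sigma (x, c0)] and [x] both solve [(C, c1, c0)] over the
      terminal object.
    - Associativity: [sigma (sigma (x, y), w)] and [sigma (x, sigma (y, w))] both
      solve [(C, c1, sigma)] over [C ** C].
    - Commutativity: [sigma (y, x)] solves [(C, c1, 1)], like [sigma (x, y)].  Its
      initial condition is the right unit law, but its differential equation
      requires that [c1] also be the derivative of [sigma] in its second
      variable: [(0 x c1) T(sigma) = sigma c1] ([solution_deriv_snd]).  Both
      sides of this equation are maps to [T C] which take the value [c1] at
      [c0] and flow along the vector field [T(c1) c] on [T C]: for [sigma c1]
      this is the hypothesis [c1 T(c1) c = c1 T(c1)] after [sigma], and for [(0 x c1) T(sigma)]
      it is the differential equation of [sigma], differentiated once and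
      rearranged with the symmetry [c] ([deriv_snd_flow]). *)

Set Implicit Arguments.
Unset Strict Implicit.
Unset Printing Implicit Defensive.

Local Open Scope cat_scope.

(** * Pairing into products and into their images under T *)

Section Pairing.
Variable X : cartesian_tangent_category.
Local Notation T := (ctc_tan X).
Local Notation z := (tzero T).
Local Notation fst := (fpr_fst (ctc_prod X) _ _).
Local Notation snd := (fpr_snd (ctc_prod X) _ _).
Local Notation "A ** B" := (prodo A B) (at level 40, left associativity).

Lemma pairm_fst (Z A B : X) (f : Z ~> A) (g : Z ~> B) : pairm f g \; fst = f.
Proof. exact: pairing0. Qed.

Lemma pairm_snd (Z A B : X) (f : Z ~> A) (g : Z ~> B) : pairm f g \; snd = g.
Proof. exact: pairing1. Qed.

Lemma prod_ext (Z A B : X) (h k : Z ~> A ** B) :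
  h \; fst = k \; fst -> h \; snd = k \; snd -> h = k.
Proof. exact: (pairing_ext (fpr_prod_univ (ctc_prod X) A B)). Qed.

Lemma comp_pairm (Y Z A B : X) (h : Y ~> Z) (f : Z ~> A) (g : Z ~> B) :
  h \; pairm f g = pairm (h \; f) (h \; g).
Proof.
by apply: prod_ext; rewrite -!compA ?pairm_fst ?pairm_snd.
Qed.

Lemma pairm_crossm (Z A A' B B' : X) (a : Z ~> A) (b : Z ~> B)
    (f : A ~> A') (g : B ~> B') :
  pairm a b \; crossm f g = pairm (a \; f) (b \; g).
Proof. by rewrite /crossm comp_pairm !compA pairm_fst pairm_snd. Qed.

Lemma pairm_id (A B : X) : pairm fst snd = idm (A ** B).
Proof. by apply: prod_ext; rewrite ?pairm_fst ?pairm_snd comp1m. Qed.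

Lemma to_one_uniq (A : X) (f g : A ~> oneo X) : f = g.
Proof.
by rewrite (bang_uniq (fpr_one_terminal (ctc_prod X)) f)
           (bang_uniq (fpr_one_terminal (ctc_prod X)) g).
Qed.

(** The pairing [Z ~> T (A ** B)] into the product cone [(T(fst), T(snd))],
    through which [T (A ** B)] is identified with [T A ** T B]. *)
Definition Tpairm (Z A B : X) (f : Z ~> T A) (g : Z ~> T B) : Z ~> T (A ** B) :=
  pairing (pp_prod (ctc_preserves X) A B) f g.

Lemma Tpairm_fst (Z A B : X) (f : Z ~> T A) (g : Z ~> T B) :
  Tpairm f g \; fmap T fst = f.
Proof. exact: (pairing0 (pp_prod (ctc_preserves X) A B)). Qed.

Lemma Tpairm_snd (Z A B : X) (f : Z ~> T A) (g : Z ~> T B) :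
  Tpairm f g \; fmap T snd = g.
Proof. exact: (pairing1 (pp_prod (ctc_preserves X) A B)). Qed.

Lemma Tprod_ext (Z A B : X) (h k : Z ~> T (A ** B)) :
  h \; fmap T fst = k \; fmap T fst -> h \; fmap T snd = k \; fmap T snd ->
  h = k.
Proof. exact: (pairing_ext (pp_prod (ctc_preserves X) A B)). Qed.

Lemma comp_Tpairm (Y Z A B : X) (h : Y ~> Z) (f : Z ~> T A) (g : Z ~> T B) :
  h \; Tpairm f g = Tpairm (h \; f) (h \; g).
Proof. by apply: Tprod_ext; rewrite -!compA ?Tpairm_fst ?Tpairm_snd. Qed.

Lemma TcrossE (A A' B B' : X) (f : A ~> T A') (g : B ~> T B') :
  Tcross f g = Tpairm (fst \; f) (snd \; g).
Proof. by []. Qed.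

Lemma pairm_Tcross (Z A A' B B' : X) (a : Z ~> A) (b : Z ~> B)
    (f : A ~> T A') (g : B ~> T B') :
  pairm a b \; Tcross f g = Tpairm (a \; f) (b \; g).
Proof. by rewrite TcrossE comp_Tpairm !compA pairm_fst pairm_snd. Qed.

Lemma comp_fmap_pairm (Y Z A B : X) (h : Y ~> T Z) (f : Z ~> A) (g : Z ~> B) :
  h \; fmap T (pairm f g) = Tpairm (h \; fmap T f) (h \; fmap T g).
Proof.
by apply: Tprod_ext; rewrite -!compA -!fmapM ?Tpairm_fst ?Tpairm_snd
  ?pairm_fst ?pairm_snd.
Qed.

(** The two maps [T^2(fst)] and [T^2(snd)] are jointly monic, because [T] sends
    the comparison isomorphism [T (A ** B) ~> T A ** T B] to an isomorphism and
    preserves the product [T A ** T B]. *)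
Lemma TTprod_ext (Z A B : X) (h k : Z ~> T (T (A ** B))) :
  h \; fmap T (fmap T fst) = k \; fmap T (fmap T fst) ->
  h \; fmap T (fmap T snd) = k \; fmap T (fmap T snd) -> h = k.
Proof.
move=> e0 e1.
pose j : T (A ** B) ~> T A ** T B := pairm (fmap T fst) (fmap T snd).
pose i : T A ** T B ~> T (A ** B) := Tpairm fst snd.
have ji : j \; i = idm _.
  by rewrite /i comp_Tpairm pairm_fst pairm_snd; apply: Tprod_ext;
    rewrite ?Tpairm_fst ?Tpairm_snd comp1m.
have hj : h \; fmap T j = k \; fmap T j.
  by apply: Tprod_ext; rewrite -!compA -!fmapM ?pairm_fst ?pairm_snd.
rewrite -[h]compm1 -[k]compm1 -fmap1 -ji fmapM !compA.
by congr (_ \; _).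
Qed.

End Pairing.

(** * Solutions of systems *)

Section Solution.
Variables (X : cartesian_tangent_category) (C : X).
Local Notation T := (ctc_tan X).
Local Notation p := (tp T).
Local Notation z := (tzero T).
Local Notation c := (tflip T).
Local Notation fst := (fpr_fst (ctc_prod X) _ _).
Local Notation snd := (fpr_snd (ctc_prod X) _ _).
Local Notation "A ** B" := (prodo A B) (at level 40, left associativity).
Variables (c1 : C ~> T C) (c0 : oneo X ~> C).

Lemma flip_proj (M : X) : c M \; p (T M) = fmap T (p M).
Proof. by rewrite (bm_square (ta_flip (ts_axioms T) M)) /= compm1. Qed.

Lemma fmap_zero_flip (M : X) : fmap T (z M) \; c M = z (T M).
Proof. by rewrite (bm_zero (ta_flip (ts_axioms T) M)) /= comp1m. Qed.

Lemma zero_flip (M : X) : z (T M) \; c M = fmap T (z M).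
Proof. by rewrite -fmap_zero_flip -compA (ta_flip_flip (ts_axioms T)) compm1. Qed.

Lemma zero_nat (A B : X) (f : A ~> B) : z A \; fmap T f = f \; z B.
Proof. by rewrite -(ntP z). Qed.

Lemma flip_nat (A B : X) (f : A ~> B) :
  fmap T (fmap T f) \; c B = c A \; fmap T (fmap T f).
Proof. exact: (ntP c f). Qed.

Lemma vector_field_fmap_flip (M : X) (V : M ~> T M) :
  vector_field V -> vector_field (fmap T V \; c M).
Proof. by move=> e; rewrite /vector_field -compA flip_proj -fmapM e fmap1. Qed.

Lemma solution_init (M Y Z : X) (V : M ~> T M) (g : Y ~> M)
    (gamma : C ** Y ~> M) (b : Z ~> Y) :
  is_solution c1 c0 V g gamma -> pairm (to_one Z \; c0) b \; gamma = b \; g.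
Proof.
case=> <- _; rewrite compA comp_pairm compm1 compA.
by rewrite (to_one_uniq (b \; to_one Y) (to_one Z)).
Qed.

Lemma solution_deriv (M Y Z : X) (V : M ~> T M) (g : Y ~> M)
    (gamma : C ** Y ~> M) (a : Z ~> C) (b : Z ~> Y) :
  is_solution c1 c0 V g gamma ->
  Tpairm (a \; c1) (b \; z Y) \; fmap T gamma = pairm a b \; (gamma \; V).
Proof. by case=> _ <-; rewrite compA pairm_Tcross. Qed.

(** The derivative of a solution [gamma] in its second variable, along any map
    [W], flows along [T(V) c].  This is the differential equation of [gamma],
    differentiated in that variable and rearranged with the symmetry [c]. *)
Lemma deriv_snd_flow (M Y Z : X) (V : M ~> T M) (W : Z ~> T Y) (g : Y ~> M)
    (gamma : C ** Y ~> M) :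
  is_solution c1 c0 V g gamma ->
  Tcross c1 (z Z) \; fmap T (Tcross (z C) W \; fmap T gamma)
  = (Tcross (z C) W \; fmap T gamma) \; (fmap T V \; c M).
Proof.
move=> [_ eq_gamma].
rewrite [RHS]compA -[X in _ = X \; _]compA -fmapM -eq_gamma !fmapM.
rewrite -!compA flip_nat !compA; congr (_ \; _).
(* on each component [f = c1, W], [0 T(f) = f 0_T], and [c] exchanges [0_T]
   with [T(0)] *)
apply: TTprod_ext; rewrite -!compA -!flip_nat !compA.
  rewrite -[LHS]compA -fmapM Tpairm_fst fmapM compA Tpairm_fst.
  rewrite -[X in _ = X \; _]compA -fmapM Tpairm_fst fmapM compA Tpairm_fst.
  by rewrite -!compA (compA (z C)) zero_nat -compA zero_flip.
rewrite -[LHS]compA -fmapM Tpairm_snd fmapM compA Tpairm_snd.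
rewrite -[X in _ = X \; _]compA -fmapM Tpairm_snd fmapM compA Tpairm_snd.
by rewrite -!compA zero_nat fmap_zero_flip.
Qed.

(** * The monoid laws *)

Hypothesis HC : curve_object c1 c0.
Variable sigma : C ** C ~> C.
Hypothesis Hsigma : is_solution c1 c0 c1 (idm C) sigma.

Lemma solution_unitr : pairm (idm C) (to_one C \; c0) \; sigma = idm C.
Proof.
(* the equation precomposed with the projection [C ** 1 ~> C] *)
have e : pairm fst (snd \; c0) \; sigma = fst :> (C ** oneo X ~> C).
  apply: (co_preinitial HC (g := c0) (co_vector_field HC)); split.
  - rewrite compA comp_pairm compA pairm_fst pairm_snd.
    by rewrite (solution_init _ Hsigma) comp1m compm1.
  - rewrite fmapM compA comp_fmap_pairm fmapM compA TcrossE Tpairm_fst Tpairm_snd.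
    rewrite -[(snd \; _) \; _]compA zero_nat compA.
    by rewrite (solution_deriv _ _ Hsigma) -compA.
  - by rewrite pairm_fst (to_one_uniq (to_one _) (idm _)) comp1m.
  - by rewrite TcrossE Tpairm_fst.
have := congr1 (fun f => pairm (idm C) (to_one C) \; f) e.
by rewrite compA comp_pairm compA pairm_fst pairm_snd.
Qed.

Lemma solution_assoc :
  crossm sigma (idm C) \; sigma
  = pairm (fst \; fst) (pairm (fst \; snd) snd) \; (crossm (idm C) sigma \; sigma).
Proof.
have e : pairm (pairm fst (snd \; fst) \; sigma) (snd \; snd) \; sigma
    = pairm fst (snd \; sigma) \; sigma :> (C ** (C ** C) ~> C).
  apply: (co_preinitial HC (g := sigma) (co_vector_field HC)); split.
  - rewrite compA !comp_pairm !compA !comp_pairm !compA pairm_fst pairm_snd.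
    by rewrite (solution_init _ Hsigma) !comp1m compm1 pairm_id comp1m.
  - rewrite fmapM compA comp_fmap_pairm !fmapM !compA comp_fmap_pairm !fmapM !compA.
    rewrite TcrossE Tpairm_fst Tpairm_snd.
    rewrite -!(compA snd) !zero_nat !compA.
    by rewrite (solution_deriv _ _ Hsigma) compA (solution_deriv _ _ Hsigma) compA.
  - rewrite compA comp_pairm compA pairm_fst pairm_snd comp1m.
    by rewrite (solution_init _ Hsigma) compm1.
  - rewrite fmapM compA comp_fmap_pairm fmapM compA TcrossE Tpairm_fst Tpairm_snd.
    rewrite -[(snd \; _) \; _]compA zero_nat compA.
    by rewrite (solution_deriv _ _ Hsigma) compA.
rewrite compA pairm_crossm compm1.
(* transport along the reassociation [(C ** C) ** C ~> C ** (C ** C)] *)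
have := congr1 (fun f => pairm (fst \; fst) (pairm (fst \; snd) snd) \; f) e.
rewrite !compA !comp_pairm !compA !comp_pairm !compA.
rewrite !pairm_fst !pairm_snd !pairm_fst => <-.
by rewrite /crossm compm1 -comp_pairm pairm_id compm1.
Qed.

Lemma solution_deriv_snd :
  Tcross (z C) c1 \; fmap T sigma = sigma \; c1.
Proof.
apply: (co_preinitial HC (g := c1)
         (vector_field_fmap_flip (co_vector_field HC))); split.
- (* [c0 0 = 0 T(c0)], so the initial value of [T(sigma)] is that of [sigma] *)
  rewrite compA pairm_Tcross comp1m -compA -zero_nat.
  have -> : Tpairm (to_one C \; z (oneo X) \; fmap T c0) c1
      = c1 \; fmap T (pairm (to_one C \; c0) (idm C)).
    rewrite comp_fmap_pairm fmap1 compm1 fmapM !compA; congr (Tpairm (_ \; _) _).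
    have [U Uu] := pp_one (ctc_preserves X).
    by rewrite (Uu _ (_ \; z _)) (Uu _ (c1 \; _)).
  by rewrite -compA -fmapM (solution_init _ Hsigma) comp1m fmap1 compm1.
- exact: deriv_snd_flow Hsigma.
- by rewrite compA (solution_init _ Hsigma) comp1m comp1m.
- rewrite fmapM compA (proj2 Hsigma) -!compA.
  by rewrite (co_commutative HC).
Qed.

Lemma solution_comm : pairm snd fst \; sigma = sigma.
Proof.
apply: (co_preinitial HC (co_vector_field HC) _ Hsigma); split.
- by rewrite compA comp_pairm pairm_fst pairm_snd solution_unitr.
- rewrite fmapM compA comp_fmap_pairm TcrossE Tpairm_fst Tpairm_snd.
  by rewrite -pairm_Tcross -compA solution_deriv_snd compA.
Qed.

End Solution.

Theorem theorem4p19 (X : cartesian_tangent_category) (C : X)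
    (c1 : C ~> ctc_tan X C) (c0 : oneo X ~> C) (HC : curve_object c1 c0)
    (sigma : prodo C C ~> C) (Hsigma : is_solution c1 c0 c1 (idm C) sigma) :
  comm_monoid sigma c0.
Proof.
split.
- exact: solution_assoc HC _ Hsigma.
- exact: (proj1 Hsigma).
- exact: solution_unitr HC _ Hsigma.
- exact: solution_comm HC _ Hsigma.
Qed.
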